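(* For any integer $r\ge1$ and any $\eta>0$: (a) for stochastic submodular cover there is a set-based $r$-round adaptive solution with expected cost at most $O\!\left(\frac{r}{\eta}Q^{1/r}\log Q\right)\cdot\mathrm{OPT}$ that covers $f$ with probability at least $1-\eta$; (b) for scenario submodular cover with $s$ scenarios there is a set-based $r$-round adaptive solution with expected cost at most $O\!\left(\frac{r}{\eta}\,s^{1/r}(\log s+r\log Q)\right)\cdot\mathrm{OPT}$ that covers $f$ with probability at least $1-\eta$. Here $\mathrm{OPT}$ is the expected cost of an optimal fully adaptive solution (which covers $f$ with probability one).
   Context: Common setting: finite ground set $U$, monotone submodular $f:2^U\to\mathbb{Z}_{\ge 0}$, $Q:=f(U)$, items $\mathbf{X}_1,\dots,\mathbf{X}_m$ with costs $c_i>0$, each realizing to an element of $U$; probing $\mathbf{X}_i$ costs $c_i$ and reveals its realization; the realized set $S$ covers $f$ if $f(S)=Q$, and the realizations of all items always cover $f$. Stochastic submodular cover: items are mutually independent with known distributions. Scenario submodular cover: the joint distribution is given explicitly by $s$ scenarios, scenario $\omega$ having probability $p_\omega>0$ and fixing the realization $X_i(\omega)$ of every item. A fully adaptive solution chooses each next item based on all realizations observed so far and must cover $f$ with probability one. A set-based $r$-round adaptive solution: in each round $i=1,\dots,r$ it selects a subset $\mathbf{S}_i$ of items (depending on the realizations observed in rounds $1,\dots,i-1$) which are all probed in parallel, incurring cost $\sum_{\mathbf{X}_j\in\mathbf{S}_i}c_j$; its cost is the expected total cost over all rounds.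
   Formalization: The factors log Q and log s + r log Q are read as 1 + log Q and 1 + log s + r log Q, because the literal bound is 0 and fails when Q = 1 (in (b), when s = Q = 1); in all other cases the added 1 is absorbed by the constant in O(.). *)

(* Defs.v *)
From HB Require Import structures.
From mathcomp Require Import all_boot all_order all_algebra.
From mathcomp Require Export reals exp.
Set Implicit Arguments. Unset Strict Implicit. Unset Printing Implicit Defensive.
Import Order.TTheory GRing.Theory Num.Theory.
Local Open Scope ring_scope.

Section SubmodularCover.
Variables (R : realType) (U : finType) (m : nat).

Definition monotone_fun (f : {set U} -> nat) : Prop :=
  forall A B : {set U}, A \subset B -> (f A <= f B)%N.
Definition submodular (f : {set U} -> nat) : Prop :=
  forall A B : {set U}, (f (A :|: B) + f (A :&: B) <= f A + f B)%N.

(** A full realization assigns to every item [X_i] (i : 'I_m) an element of U. *)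
Definition realization := {ffun 'I_m -> U}.
(** Observed state: [Some u] for items already probed (with realization u),
    [None] for items not yet probed. *)
Definition state := {ffun 'I_m -> option U}.
Definition init_state : state := [ffun => None].

Definition observe (st : state) (x : realization) (i : 'I_m) : state :=
  [ffun j => if j == i then Some (x j) else st j].
Definition observe_set (st : state) (x : realization) (S : {set 'I_m}) : state :=
  [ffun j => if j \in S then Some (x j) else st j].

Definition obs_set (st : state) : {set U} :=
  [set u | [exists i, st i == Some u]].
Definition covers (f : {set U} -> nat) (st : state) : bool :=
  f (obs_set st) == f [set: U].

(** Fully adaptive policy: given everything observed so far, pick the next item
    to probe, or stop ([None]).  Run on realization [x] with [fuel] steps;
    returns final state and total probing cost. *)
Fixpoint adapt_run (c : 'I_m -> R) (pi : state -> option 'I_m)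
    (x : realization) (fuel : nat) (st : state) : state * R :=
  match fuel with
  | 0 => (st, 0)
  | n.+1 =>
    match pi st with
    | None => (st, 0)
    | Some i => let p := adapt_run c pi x n (observe st x i) in (p.1, c i + p.2)
    end
  end.
(** m steps suffice for any policy that never re-probes an item. *)
Definition adapt_result c pi x := adapt_run c pi x m init_state.

(** Set-based round-adaptive policy: in round k (k = 0,...,r-1) it selects
    [sigma k st] based on the state [st] observed in previous rounds; all
    selected items are probed in parallel and all their costs are paid. *)
Fixpoint rounds_run (c : 'I_m -> R) (sigma : nat -> state -> {set 'I_m})
    (x : realization) (n : nat) : state * R :=
  match n with
  | 0 => (init_state, 0)
  | n'.+1 =>
    let p := rounds_run c sigma x n' in
    let S := sigma n' p.1 in
    (observe_set p.1 x S, p.2 + \sum_(j in S) c j)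
  end.

Definition expected (D : realization -> R) (g : realization -> R) : R :=
  \sum_(x : realization) D x * g x.

Definition adapt_feasible c (f : {set U} -> nat) (D : realization -> R) pi : Prop :=
  forall x, 0 < D x -> covers f (adapt_result c pi x).1.
Definition adapt_cost c (D : realization -> R) pi : R :=
  expected D (fun x => (adapt_result c pi x).2).

Definition rounds_cost c (D : realization -> R) sigma r : R :=
  expected D (fun x => (rounds_run c sigma x r).2).
Definition rounds_cover_prob c (f : {set U} -> nat) (D : realization -> R) sigma r : R :=
  expected D (fun x => (covers f (rounds_run c sigma x r).1)%:R).

Definition product_dist (p : 'I_m -> {ffun U -> R}) : realization -> R :=
  fun x => \prod_(i < m) p i (x i).
Definition scenario_dist (s : nat) (q : 'I_s -> R) (X : 'I_s -> realization)
  : realization -> R :=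
  fun x => \sum_(w < s | X w == x) q w.

End SubmodularCover.

(* Main.v *)
Require Import Defs.
From HB Require Import structures.
From mathcomp Require Import all_boot all_order all_algebra.
From mathcomp Require Import reals exp ring lra.
Import Order.TTheory GRing.Theory Num.Theory.
Set Implicit Arguments.
Unset Strict Implicit.
Unset Printing Implicit Defensive.
Local Open Scope ring_scope.

(** Let [pi] be a cheapest feasible adaptive policy and [P x] the set of items it
    probes on the realization [x].  In every round, condition on the state, draw
    [k] independent realizations [w_1, ..., w_k] and probe the union [N] of the
    sets [P w_j]; in expectation this costs at most [k OPT].

    A nonnegative potential, at least [1] on uncovered states, shrinks in
    expectation by a factor [2 / (k + 1)] per round, by symmetry between the
    actual realization [x = w_0] and the sampled ones.

    - Independent items, potential [f U - f S].  Let [y] be an independent copy of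
      [x].  Exchanging [x_e] and [y_e] for the items [e] outside [N] probed by [pi]
      shows that the expected residual is at most twice the expected gain of
      [y_(P x \ N)] over [x_N], hence over [y_(N \ P x)] after exchanging [x] and
      [y] outside [P x].  For fixed [y], the gains of the items probed by only one
      of the [k + 1] runs sum up to at most [f U - f set0].

    - Scenarios, potential = number of scenarios consistent with an uncovered
      state.  If the [i]-th and the [j]-th of the [k + 1] realizations are both
      uncovered by the other runs, no scenario is consistent with both.

    After [r] rounds the failure probability is at most [(2 / (k + 1)) ^ r Z], with
    [Z = Q] or [Z = s], so [k ~ (4 / eta) Z ^ (1 / r)] suffices; the random choices
    are removed by averaging a combination of cost and potential. *)

(** * Product weights and coordinate exchange between two independent copies *)

Section ProductWeight.
Variables (R : realFieldType) (I T : finType) (p : I -> T -> R).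
Hypotheses (p_ge0 : forall i t, 0 <= p i t) (p_sum1 : forall i, \sum_t p i t = 1).

Definition pweight (x : {ffun I -> T}) : R := \prod_i p i (x i).

Lemma pweight_ge0 x : 0 <= pweight x.
Proof. by apply: prodr_ge0 => i _. Qed.

Lemma sum_pweight : \sum_x pweight x = 1.
Proof. by rewrite -bigA_distr_bigA big1. Qed.

Lemma sum_pweight_marginal i (g : T -> R) :
  \sum_x pweight x * g (x i) = \sum_t p i t * g t.
Proof.
pose F j t := p j t * (if j == i then g t else 1).
transitivity (\sum_(x : {ffun I -> T}) \prod_j F j (x j)).
  apply: eq_bigr => x _; rewrite /F big_split /= -/(pweight x); congr (_ * _).
  by rewrite -big_mkcond big_pred1_eq.
rewrite -bigA_distr_bigA (bigD1 i) //= [X in _ * X]big1 ?mulr1 => [|j ji].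
  by apply: eq_bigr => t _; rewrite /F eqxx.
by rewrite -[RHS](p_sum1 j); apply: eq_bigr => t _; rewrite /F (negPf ji) mulr1.
Qed.

Definition swap_on (S : {set I}) (z : {ffun I -> T} * {ffun I -> T}) :=
  ([ffun i => if i \in S then z.2 i else z.1 i],
   [ffun i => if i \in S then z.1 i else z.2 i]).

Lemma swap_onK S : involutive (swap_on S).
Proof.
move=> [x y]; congr (_, _); apply/ffunP=> i; rewrite !ffunE /=;
  by case: ifP => iS; rewrite ?ffunE /= ?iS.
Qed.

Lemma pweight_swap_on S z :
  pweight (swap_on S z).1 * pweight (swap_on S z).2 = pweight z.1 * pweight z.2.
Proof.
rewrite -!big_split /=; apply: eq_bigr => i _; rewrite !ffunE.
by case: ifP => // _; rewrite mulrC.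
Qed.

(** The exchanged coordinates may depend on the pair: as [S] is unchanged by its own exchange, the
    map is still an involution, and it preserves the joint weight. *)
Lemma sum_pweight_swap (S : {ffun I -> T} * {ffun I -> T} -> {set I}) h :
  (forall z, S (swap_on (S z) z) = S z) ->
  \sum_z pweight z.1 * pweight z.2 * h z =
  \sum_z pweight z.1 * pweight z.2 * h (swap_on (S z) z).
Proof.
move=> SE; rewrite (reindex_inj (h := fun z => swap_on (S z) z)) /=; last first.
  by apply: inv_inj => z; rewrite SE swap_onK.
by apply: eq_bigr => z _; rewrite pweight_swap_on.
Qed.

Lemma sum_pweight_pairl (h : {ffun I -> T} -> R) :
  \sum_z pweight z.1 * pweight z.2 * h z.1 = \sum_x pweight x * h x.
Proof.
rewrite -(pair_bigA _ (fun x y => pweight x * pweight y * h x)) /=.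
apply: eq_bigr => x _; rewrite -mulr_suml -mulr_sumr.
by rewrite sum_pweight mulr1.
Qed.

End ProductWeight.

(** * Averaging over independent samples with one left out *)

Section LeaveOneOut.
Variables (R : realFieldType) (T I : finType) (mu : T -> R) (P : T -> {set I}).
Hypotheses (mu_ge0 : forall x, 0 <= mu x) (mu_sum1 : \sum_x mu x = 1).

Definition others n (ws : {ffun 'I_n -> T}) (i : 'I_n) : {set I} :=
  \bigcup_(j | j != i) P (ws j).

(** Among [k.+1] independent draws, each [ws i] is independent of [others ws i], so the mean of
    [F (ws i) (others ws i)] is at least the least value of [phi]. Summing over [i] compares [k.+1]
    times this minimum with [k.+1] times the mean of [b]. *)
Lemma leave_one_out k (F : T -> {set I} -> R) (b : T -> R) :
  (forall ws : {ffun 'I_k.+1 -> T}, (forall i, 0 < mu (ws i)) ->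
     \sum_i F (ws i) (others ws i) <= \sum_i b (ws i)) ->
  exists N : {set I}, \sum_x mu x * F x N <= \sum_x mu x * b x.
Proof.
move=> Fb; pose phi N := \sum_x mu x * F x N.
case: (@Order.TotalTheory.arg_minP _ R _ set0 xpredT phi isT) => N _ minN.
exists N; rewrite -/(phi N).
pose w := @pweight R 'I_k.+1 T (fun=> mu).
have w_ge0 ws : 0 <= w ws by exact: pweight_ge0.
have w_sum1 : \sum_ws w ws = 1 by exact: sum_pweight.
have k_gt0 : 0 < k.+1%:R :> R by rewrite ltr0n.
rewrite -(ler_pM2l k_gt0).
apply: (@le_trans _ _ (\sum_ws w ws * \sum_i F (ws i) (others ws i))); last first.
  apply: (@le_trans _ _ (\sum_ws w ws * \sum_i b (ws i))).
    apply: ler_sum => ws _.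
    have [pos|] := boolP [forall i, 0 < mu (ws i)].
      by apply: ler_wpM2l => //; apply: Fb => i; exact: (forallP pos).
    rewrite negb_forall => /existsP[i]; rewrite lt_def mu_ge0 andbT negbK => /eqP wi0.
    suff -> : w ws = 0 by rewrite !mul0r.
    by rewrite /w /pweight (bigD1 i) //= wi0 mul0r.
  under eq_bigr do rewrite mulr_sumr.
  rewrite exchange_big /= (eq_bigr (fun=> \sum_x mu x * b x)) => [|i _].
    by rewrite sumr_const card_ord mulr_natl.
  exact: (sum_pweight_marginal (fun=> mu_sum1)).
under [leRHS]eq_bigr do rewrite mulr_sumr.
rewrite exchange_big /= mulr_natl -[X in _ *+ X]card_ord -sumr_const.
apply: ler_sum => i _.
(* A second tuple is drawn and coordinate [i] exchanged with it: the left-out point becomes [z.2 i],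
   while [others] still reads [z.1] only. *)
rewrite -(sum_pweight_pairl (p := fun=> mu) (fun=> mu_sum1)).
rewrite (sum_pweight_swap (fun=> mu) (S := fun=> [set i])) //=.
have -> : \sum_z w z.1 * w z.2 *
    F ([ffun j => if j \in [set i] then z.2 j else z.1 j] i)
      (others [ffun j => if j \in [set i] then z.2 j else z.1 j] i) =
    \sum_z w z.1 * w z.2 * F (z.2 i) (others z.1 i).
  apply: eq_bigr => z _; rewrite ffunE set11; congr (_ * F _ _).
  by apply: eq_bigr => j ji; rewrite ffunE inE (negPf ji).
rewrite -(pair_bigA _ (fun x y => w x * w y * F (y i) (others x i))) /=.
rewrite -[leLHS]mul1r -w_sum1 mulr_suml; apply: ler_sum => ws _.
under eq_bigr do rewrite -mulrA.
rewrite -mulr_sumr; apply: ler_wpM2l => //.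
by rewrite (sum_pweight_marginal (fun=> mu_sum1) i (fun x => F x (others ws i))); exact: minN.
Qed.

End LeaveOneOut.

(** * Diminishing returns and telescoping along a sequence *)

Lemma marginal_le (U : finType) (f : {set U} -> nat) (A B C : {set U}) :
  monotone_fun f -> submodular f -> A \subset B ->
  (f (B :|: C) + f A <= f (A :|: C) + f B)%N.
Proof.
(* The union of [A :|: C] and [B] is [B :|: C], and their intersection contains [A]. *)
move=> f_mono f_sub AB; apply: leq_trans (f_sub (A :|: C) B).
rewrite -setUA [C :|: B]setUC setUA (setUidPr AB) leq_add2l.
by apply: f_mono; rewrite subsetI subsetUl.
Qed.

Definition before (I : finType) (s : seq I) (e : I) : {set I} :=
  [set x in take (index e s) s].

Lemma notin_before (I : finType) (s : seq I) e : e \notin before s e.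
Proof. by rewrite inE; apply/negP => /index_ltn; rewrite ltnn. Qed.

(** [before] stops at the first occurrence, so a repeated last element changes neither the set of
    entries nor any prefix. *)
Lemma telescope_before (R : zmodType) (I : finType) (G : {set I} -> R) (s : seq I) :
  G [set x in s] - G set0 = \sum_(e in s) (G (e |: before s e) - G (before s e)).
Proof.
elim/last_ind: s => [|s x IHs].
  by rewrite big_pred0 // (_ : [set x in [::]] = set0) ?subrr //; apply/setP=> x; rewrite !inE.
have beforeE e : e \in s -> before (rcons s x) e = before s e.
  move=> es; rewrite /before -cats1 index_cat es takel_cat //.
  exact: index_size.
have [xs|xs] := boolP (x \in s).
  have memE : rcons s x =i s.
    by move=> e; rewrite mem_rcons inE; case: eqP => // ->.
  rewrite (eq_bigl _ _ memE) (_ : [set y in rcons s x] = [set y in s]).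
    by rewrite IHs; apply: eq_bigr => e es; rewrite beforeE.
  by apply/setP=> e; rewrite !inE memE.
have bx : before (rcons s x) x = [set y in s].
  by rewrite /before -cats1 index_cat (negPf xs) /= eqxx addn0 take_size_cat.
rewrite (bigD1 x) /=; last by rewrite mem_rcons mem_head.
rewrite bx [X in _ = _ + X](_ : _ = G [set y in s] - G set0).
  rewrite addrA subrK; congr (G _ - _).
  by apply/setP=> e; rewrite !inE mem_rcons inE.
rewrite IHs; apply: eq_big => [e|e /andP[]].
  by rewrite mem_rcons inE; case: eqP => [->|] //=; rewrite ?andbT ?(negPf xs).
by rewrite mem_rcons inE => /orP[->//|es _]; rewrite beforeE.
Qed.

(** * Runs of adaptive policies and the states they observe *)

Section Policy.
Variables (R : realType) (U : finType) (m : nat).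
Implicit Types (st : state U m) (x y : realization U m).

Definition agrees st x : bool := [forall i, (st i == None) || (st i == Some (x i))].

Lemma agreesP st x :
  reflect (forall i u, st i = Some u -> x i = u) (agrees st x).
Proof.
apply: (iffP forallP) => [h i u sti|h i].
  by move: (h i); rewrite sti /= => /eqP[].
by case sti: (st i) => [u|] //=; rewrite (h _ _ sti) eqxx.
Qed.

Lemma agrees_init x : agrees (init_state U m) x.
Proof. by apply/agreesP => i u; rewrite ffunE. Qed.

Lemma agrees_observe_set st x y (S : {set 'I_m}) : agrees st x ->
  agrees (observe_set st x S) y =
  agrees st y && [forall (i | i \in S), x i == y i].
Proof.
move=> /agreesP stx; apply/agreesP/andP => [h|[/agreesP sty /forall_inP xy] i u].
  split.
    apply/agreesP => i u sti; apply: h; rewrite ffunE; case: ifP => // _.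
    by rewrite (stx _ _ sti).
  by apply/forall_inP => i iS; rewrite (h i (x i)) // ffunE iS.
by rewrite ffunE; case: ifP => [iS [<-]|_]; [rewrite (eqP (xy _ iS)) | apply: sty].
Qed.

Lemma obs_observe_set st x (S : {set 'I_m}) : agrees st x ->
  obs_set (observe_set st x S) = obs_set st :|: x @: S.
Proof.
move=> /agreesP stx; apply/setP=> u; rewrite !inE; apply/existsP/orP => [[i]|].
  rewrite ffunE; case: ifP => [iS /eqP[<-]|_ sti]; first by right; apply: imset_f.
  by left; apply/existsP; exists i.
case=> [/existsP[i /eqP sti]|/imsetP[i iS ->]]; exists i; rewrite ffunE ?iS ?eqxx //.
by case: ifP => _; rewrite ?sti // (stx _ _ sti).
Qed.

Lemma obs_init : obs_set (init_state U m) = set0.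
Proof. by apply/setP=> u; rewrite !inE; apply/existsP => -[i]; rewrite ffunE. Qed.

Variable pi : state U m -> option 'I_m.

Fixpoint probes x (n : nat) st : seq 'I_m :=
  if n is n'.+1 then
    if pi st is Some i then i :: probes x n' (observe st x i) else [::]
  else [::].

Definition trace x := probes x m (init_state U m).
Definition probed x : {set 'I_m} := [set i in trace x].

Lemma adapt_run_state (c : 'I_m -> R) x n st :
  (adapt_run c pi x n st).1 = observe_set st x [set i in probes x n st].
Proof.
elim: n st => [|n IHn] st /=.
  by apply/ffunP => j; rewrite !ffunE inE.
case: (pi st) => [i|] /=; last by apply/ffunP => j; rewrite !ffunE inE.
rewrite IHn; apply/ffunP => j; rewrite !ffunE !inE.
by case: (j == i); case: ifP.
Qed.

Lemma adapt_run_cost (c : 'I_m -> R) x n st :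
  (adapt_run c pi x n st).2 = \sum_(i <- probes x n st) c i.
Proof.
elim: n st => [|n IHn] st /=; first by rewrite big_nil.
by case: (pi st) => [i|] /=; rewrite ?big_nil // big_cons IHn.
Qed.

(** Whether [e] gets probed, and after which items, is decided before its realization is seen. *)
Lemma probes_update x y e n st : (forall j, j != e -> x j = y j) ->
  (e \in probes x n st) = (e \in probes y n st) /\
  before (probes x n st) e = before (probes y n st) e.
Proof.
move=> xy.
suff: (e \in probes x n st) = (e \in probes y n st) /\
  take (index e (probes x n st)) (probes x n st) =
  take (index e (probes y n st)) (probes y n st).
  by rewrite /before => -[-> ->].
elim: n st => [|n IHn] st //=; case: (pi st) => [i|] //=.
have [->|ie] := eqVneq i e; first by rewrite !inE eqxx.
have -> : observe st y i = observe st x i.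
  by apply/ffunP => j; rewrite !ffunE; case: eqP => // ->; rewrite xy.
by rewrite !inE /=; have [-> ->] := IHn (observe st x i).
Qed.

(** Two runs can part only after an item that both have probed and on which the realizations
    differ. *)
Lemma probes_eq x y n st :
  {in [predI probes x n st & probes y n st], x =1 y} ->
  probes x n st = probes y n st.
Proof.
elim: n st => [|n IHn] st //=; case: (pi st) => [i|] //= xy.
have xyi : x i = y i by apply: xy; rewrite !inE eqxx.
have E : observe st y i = observe st x i.
  by apply/ffunP => j; rewrite !ffunE; case: eqP => // ->; rewrite xyi.
rewrite E IHn // => j; rewrite inE => /andP[jx jy].
by apply: xy; rewrite !inE E jx jy !orbT.
Qed.

Lemma trace_eq x y : {in [predI probed x & probed y], x =1 y} -> trace x = trace y.
Proof.
by move=> xy; apply: probes_eq => i /andP[ix iy]; apply: xy; rewrite !inE ix iy.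
Qed.

(** Only an inequality, since a policy pays again when it probes an item twice. *)
Lemma cost_probed (c : 'I_m -> R) x : (forall i, 0 <= c i) ->
  \sum_(i in probed x) c i <= (adapt_result c pi x).2.
Proof.
move=> c_ge0; rewrite /adapt_result adapt_run_cost -/(trace x).
rewrite /probed; elim: (trace x) => [|i s IHs].
  by rewrite big_nil big_pred0 // => i; rewrite inE.
rewrite big_cons set_cons; have [is_|is_] := boolP (i \in [set j in s]).
  by rewrite (setUidPr _) ?sub1set // -[leLHS]add0r lerD.
by rewrite big_setU1 //= lerD2l.
Qed.
End Policy.

(** * One round with independent items *)

Section IndependentRound.
Variables (R : realType) (U : finType) (m : nat).
Variables (p : 'I_m -> U -> R) (g : {set U} -> nat) (pi : state U m -> option 'I_m).
Hypotheses (p_ge0 : forall i u, 0 <= p i u) (p_sum1 : forall i, \sum_u p i u = 1).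
Hypotheses (g_mono : monotone_fun g) (g_sub : submodular g).
Hypothesis pi_covers :
  forall x, 0 < pweight p x -> g (x @: probed pi x) = g [set: U].

Local Notation P := (probed pi).
Local Notation w := (pweight p).
Let G (A : {set U}) : R := (g A)%:R.

Let G_marginal (A B C : {set U}) : A \subset B -> G (B :|: C) - G B <= G (A :|: C) - G A.
Proof.
move=> AB; rewrite lerBlDr addrAC lerBrDr -!natrD ler_nat.
exact: marginal_le.
Qed.

Let G_mono (A B : {set U}) : A \subset B -> G A <= G B.
Proof. by move=> AB; rewrite ler_nat; apply: g_mono. Qed.

Section FixedSet.
Variable N : {set 'I_m}.

(* [z.1] drives the policy and [z.2] is an independent copy: using the copies of
   the items probed before [e] keeps this set independent of [z.1 e]. *)
Let ctx (z : realization U m * realization U m) (e : 'I_m) : {set U} :=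
  (z.1 @: N) :|: (z.2 @: (before (trace pi z.1) e :\: N)).

Let gain (z : realization U m * realization U m) e u : R :=
  if (e \in P z.1) && (e \notin N) then G (ctx z e :|: [set u]) - G (ctx z e) else 0.

(** Exchanging the coordinate [e] of the two copies turns [z.1 e] into [z.2 e]; by [probes_update]
    neither the event that [e] is probed nor [ctx z e] is affected. *)
Let gain_swap e :
  \sum_z w z.1 * w z.2 * gain z e (z.1 e) = \sum_z w z.1 * w z.2 * gain z e (z.2 e).
Proof.
rewrite (sum_pweight_swap _ (S := fun=> [set e])) //; apply: eq_bigr => z _; congr (_ * _).
rewrite /gain; set z' := swap_on _ _.
have z1 j : j != e -> z'.1 j = z.1 j by move=> je; rewrite ffunE inE (negPf je).
have z2 j : j != e -> z'.2 j = z.2 j by move=> je; rewrite ffunE inE (negPf je).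
have [memE befE] := @probes_update _ _ pi z'.1 z.1 e m (init_state U m) z1.
have -> : (e \in P z'.1) = (e \in P z.1) by rewrite !inE.
case: ifP => // /andP[_ eN]; have -> : z'.1 e = z.2 e by rewrite ffunE set11.
suff -> : ctx z' e = ctx z e by [].
rewrite /ctx /trace befE; congr (_ :|: _); apply: eq_in_imset => j.
  by move=> jN; apply: z1; apply: contraNneq eN => <-.
rewrite inE => /andP[_ jb]; apply: z2; apply: contraTneq jb => ->.
exact: notin_before.
Qed.

(** The items probed on [z.1] cover everything. Along the trace, both realizations of each item
    outside [N] are added to [z.1 @: N]; each increment splits into two marginal gains, and both
    only grow over the smaller base [ctx z e]. *)
Let residual_gain z : 0 < w z.1 ->
  (g [set: U])%:R - G (z.1 @: N) <= \sum_e (gain z e (z.1 e) + gain z e (z.2 e)).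
Proof.
move=> wz; pose H A := G (z.1 @: N :|: z.1 @: (A :\: N) :|: z.2 @: (A :\: N)).
have H0 : H set0 = G (z.1 @: N) by rewrite /H set0D !imset0 !setU0.
have HP : (g [set: U])%:R <= H (P z.1).
  rewrite -(pi_covers wz); apply: G_mono; rewrite -imsetU.
  apply: subset_trans (subsetUl _ _); rewrite imsetS //.
  by apply/subsetP => i iP; rewrite in_setU in_setD iP andbT; case: (i \in N).
rewrite -H0; apply: (le_trans (lerB HP (lexx _))); rewrite telescope_before.
rewrite big_mkcond /=; apply: ler_sum => e _; rewrite /gain.
have -> : (e \in P z.1) = (e \in trace pi z.1) by rewrite inE.
case: ifP => /= [et|_]; last by rewrite addr0.
have [eN|eN] := boolP (e \in N); rewrite /= ?addr0.
  rewrite /H (_ : (e |: _) :\: N = before (trace pi z.1) e :\: N) ?subrr //.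
  by apply/setP=> j; rewrite !inE; case: eqP => // ->; rewrite eN.
set h := before _ e; set A := ctx z e; rewrite /H.
have -> : (e |: h) :\: N = e |: (h :\: N).
  by apply/setP=> j; rewrite !inE; case: eqP => // ->; rewrite eN.
set B := z.1 @: N :|: z.1 @: (h :\: N) :|: z.2 @: (h :\: N).
have AB : A \subset B by apply: setSU; exact: subsetUl.
rewrite !imsetU1 (_ : _ :|: _ :|: _ = B :|: [set z.1 e] :|: [set z.2 e]); last first.
  apply/setP=> u; rewrite !in_setU !in_set1.
  by case: (u == z.1 e); case: (u == z.2 e); rewrite ?(orbT, orbF).
rewrite -[_ - G B](subrKA (G (B :|: [set z.1 e]))) addrC lerD ?G_marginal //.
by apply: subset_trans AB (subsetUl _ _).
Qed.

(** With realizations from [z.2], the bases [ctx z e] are exactly the successive prefixes, so the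
    gains telescope. *)
Let gain_copy z :
  \sum_e gain z e (z.2 e) = G (z.1 @: N :|: z.2 @: (P z.1 :\: N)) - G (z.1 @: N).
Proof.
pose H A := G (z.1 @: N :|: z.2 @: (A :\: N)).
have H0 : H set0 = G (z.1 @: N) by rewrite /H set0D !imset0 !setU0.
rewrite -H0 -/(H (P z.1)) telescope_before [RHS]big_mkcond; apply: eq_bigr => e _.
rewrite /gain; have -> : (e \in P z.1) = (e \in trace pi z.1) by rewrite inE.
case: ifP => [/andP[-> eN]|]; last first.
  case: ifP => //= _ /negbFE eN.
  rewrite /H (_ : (e |: _) :\: N = before (trace pi z.1) e :\: N) ?subrr //.
  by apply/setP=> j; rewrite !inE; case: eqP => // ->; rewrite eN.
rewrite /H /ctx (_ : (e |: _) :\: N = e |: (before (trace pi z.1) e :\: N)).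
  by rewrite imsetU1 [[set _] :|: _]setUC setUA.
by apply/setP=> j; rewrite !inE; case: eqP => // ->; rewrite eN.
Qed.

(** Here [x] only selects items, and all values come from [y]; this lets the gains of several runs
    be summed for one fixed [y]. *)
Definition exclusive_gain (x y : realization U m) : R :=
  G (y @: (N :\: P x) :|: y @: (P x :\: N)) - G (y @: (N :\: P x)).

Lemma residual_le_exclusive :
  \sum_x w x * ((g [set: U])%:R - (g (x @: N))%:R) <=
  2 * \sum_z w z.1 * w z.2 * exclusive_gain z.1 z.2.
Proof.
have w_ge0 x : 0 <= w x by exact: pweight_ge0.
rewrite -(sum_pweight_pairl p_sum1).
apply: (@le_trans _ _
  (\sum_z w z.1 * w z.2 * \sum_e (gain z e (z.1 e) + gain z e (z.2 e)))).
  apply: ler_sum => z _; have [->|wz] := eqVneq (w z.1) 0; first by rewrite !mul0r.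
  by rewrite ler_wpM2l ?mulr_ge0 // residual_gain // lt_def wz w_ge0.
under eq_bigr do rewrite mulr_sumr.
rewrite exchange_big /=.
under eq_bigr do (under eq_bigr do rewrite mulrDr;
  rewrite big_split /= gain_swap -mulr2n -mulr_natl).
rewrite -mulr_sumr exchange_big /= ler_wpM2l //.
under eq_bigr do rewrite -mulr_sumr gain_copy.
(* The run on [z.1] never looks outside [P z.1], so the exchange there leaves it unchanged. *)
have probed_swap z : P (swap_on (~: P z.1) z).1 = P z.1.
  suff E : trace pi (swap_on (~: P z.1) z).1 = trace pi z.1 by rewrite /probed E.
  apply: trace_eq => i /andP[_ iP].
  by rewrite /= ffunE in_setC [i \in _]iP.
rewrite [leRHS](sum_pweight_swap _ (S := fun z => ~: P z.1)) => [|z]; last first.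
  by rewrite probed_swap.
apply: ler_sum => z _; rewrite ler_wpM2l ?mulr_ge0 //.
rewrite /exclusive_gain probed_swap; set z' := swap_on _ z.
have -> : z'.2 @: (N :\: P z.1) = z.1 @: (N :\: P z.1).
  by apply: eq_in_imset => i; rewrite in_setD ffunE in_setC => /andP[->].
have -> : z'.2 @: (P z.1 :\: N) = z.2 @: (P z.1 :\: N).
  by apply: eq_in_imset => i; rewrite in_setD ffunE in_setC => /andP[_ ->].
(* Removing the probed items from the base [z.1 @: N] can only raise the gain. *)
by apply: G_marginal; rewrite imsetS // subsetDl.
Qed.

End FixedSet.

(** [B i] holds the items that run [i] alone probes. The base of its gain contains [B j] for every
    other [j], so the gain is at most the increment when the [B i] are added one after another. *)
Lemma exclusive_gain_sum n (ws : {ffun 'I_n -> realization U m}) (y : realization U m) :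
  \sum_i exclusive_gain (others P ws i) (ws i) y <= (g [set: U])%:R - (g set0)%:R.
Proof.
pose B i := P (ws i) :\: others P ws i.
pose A (J : {set 'I_n}) := y @: \bigcup_(j in J) B j.
have step (i : 'I_n) (J : {set 'I_n}) : i \notin J ->
    exclusive_gain (others P ws i) (ws i) y <= G (A (i |: J)) - G (A J).
  move=> iJ; have -> : A (i |: J) = A J :|: y @: B i.
    by rewrite /A bigcup_setU big_set1 imsetU setUC.
  apply: G_marginal; rewrite /A imsetS //; apply/bigcupsP => j jJ.
  have ji : j != i by apply: contraNneq iJ => <-.
  apply/subsetP => e; rewrite inE => /andP[ej eP]; rewrite inE; apply/andP; split.
    apply: contra ej => ei; apply/bigcupP; exists i => //.
    by rewrite eq_sym.
  by apply/bigcupP; exists j.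
apply: (@le_trans _ _ (G (A [set i in enum 'I_n]) - G (A set0))).
  rewrite (telescope_before (G \o A)) [leRHS](eq_bigl xpredT) => [|i]; last by rewrite mem_enum.
  by apply: ler_sum => i _; apply: step; exact: notin_before.
by apply: lerB; apply: G_mono; rewrite ?sub0set ?subsetT.
Qed.

End IndependentRound.

(** * Composing rounds: cost against potential *)

Section Rounds.
Variables (R : realType) (U : finType) (m : nat).
Implicit Types (sigma : nat -> state U m -> {set 'I_m}) (x y : realization U m).
Variables (c : 'I_m -> R) (D : realization U m -> R).
Hypotheses (c_gt0 : forall i, 0 < c i) (D_ge0 : forall x, 0 <= D x).

Lemma rounds_run_ext sigma sigma' x n : (forall i, (i < n)%N -> sigma i =1 sigma' i) ->
  rounds_run c sigma x n = rounds_run c sigma' x n.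
Proof.
elim: n => [|n IHn] //= E.
by rewrite IHn => [|i ni]; [rewrite E|apply: E; exact: ltnW].
Qed.

Lemma agrees_rounds_run sigma x n : agrees (rounds_run c sigma x n).1 x.
Proof.
elim: n => [|n IHn] /=; first exact: agrees_init.
by rewrite agrees_observe_set // IHn; apply/forall_inP.
Qed.

(** A run depends on the realization only through what it reveals, so the realizations ending in a
    reached state are exactly those agreeing with it. *)
Lemma rounds_run_agrees sigma x y n :
  agrees (rounds_run c sigma x n).1 y -> (rounds_run c sigma y n).1 = (rounds_run c sigma x n).1.
Proof.
elim: n => [|n IHn] //=.
rewrite agrees_observe_set ?agrees_rounds_run // => /andP[/IHn -> /forall_inP xy].
by apply/ffunP => i; rewrite !ffunE; case: ifP => // /xy/eqP->.
Qed.

Lemma rounds_sum_le sigma n (h1 h2 : state U m -> realization U m -> R) :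
  (forall st, \sum_(x | agrees st x) h1 st x <= \sum_(x | agrees st x) h2 st x) ->
  \sum_x h1 (rounds_run c sigma x n).1 x <= \sum_x h2 (rounds_run c sigma x n).1 x.
Proof.
move=> h12; pose S x := (rounds_run c sigma x n).1.
rewrite (partition_big S xpredT) // [leRHS](partition_big S xpredT) //=.
apply: ler_sum => st _.
rewrite (eq_bigr (h1 st)) => [|x /eqP<-//].
rewrite [leRHS](eq_bigr (h2 st)) => [|x /eqP<-//].
have [y /eqP yst|none] := pickP (fun y => S y == st); last by rewrite !big_pred0.
have SE x : (S x == st) = agrees st x.
  apply/eqP/idP => [<-|]; first exact: agrees_rounds_run.
  by rewrite -yst => /rounds_run_agrees.
by rewrite !(eq_bigl _ _ SE).
Qed.

Lemma rounds_cost_ge0 sigma n : 0 <= rounds_cost c D sigma n.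
Proof.
apply: sumr_ge0 => x _; apply: mulr_ge0 => //.
by elim: n => //= n IHn; rewrite addr_ge0 // sumr_ge0 // => j _; exact: ltW.
Qed.

Lemma rounds_run_empty x n : rounds_run c (fun _ _ => set0) x n = (init_state U m, 0).
Proof.
elim: n => //= n ->; rewrite big_set0 addr0; congr (_, _).
by apply/ffunP => i; rewrite ffunE inE.
Qed.

Lemma rounds_cost_empty n : rounds_cost c D (fun _ _ => set0) n = 0.
Proof.
by rewrite /rounds_cost /expected big1 // => x _; rewrite rounds_run_empty mulr0.
Qed.

Variable pi : state U m -> option 'I_m.

Lemma adapt_result_ge0 x : 0 <= (adapt_result c pi x).2.
Proof. by rewrite /adapt_result adapt_run_cost sumr_ge0 // => i _; exact: ltW. Qed.

Lemma adapt_cost_ge0 : 0 <= adapt_cost c D pi.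
Proof. by apply: sumr_ge0 => x _; rewrite mulr_ge0 // adapt_result_ge0. Qed.

(** Costs being positive, a policy of zero expected cost probes nothing on any [x] of positive
    probability. *)
Lemma adapt_cost0 (f : {set U} -> nat) x : adapt_feasible c f D pi ->
  adapt_cost c D pi = 0 -> 0 < D x -> covers f (init_state U m).
Proof.
move=> feas cost0 Dx.
have terms_ge0 y : true -> 0 <= D y * (adapt_result c pi y).2.
  by move=> _; rewrite mulr_ge0 // adapt_result_ge0.
have /eqP := psumr_eq0P terms_ge0 cost0 (i := x) isT.
rewrite mulf_eq0 gt_eqF //= /adapt_result adapt_run_cost => /eqP trace0.
have := feas _ Dx; rewrite /adapt_result adapt_run_state.
case: probes trace0 => [_|i s].
  by rewrite (_ : observe_set _ _ _ = init_state U m) //; apply/ffunP => i; rewrite !ffunE inE.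
rewrite big_cons => /eqP; rewrite gt_eqF // ltr_wpDr // sumr_ge0 // => j _; exact: ltW.
Qed.

Lemma sum_bigcup_le (I J : finType) (B : J -> {set I}) (Pj : pred J) (a : I -> R) :
  (forall i, 0 <= a i) ->
  \sum_(i in \bigcup_(j | Pj j) B j) a i <= \sum_(j | Pj j) \sum_(i in B j) a i.
Proof.
move=> a_ge0; under [leRHS]eq_bigr do rewrite big_mkcond.
rewrite exchange_big big_mkcond; apply: ler_sum => i _ /=.
case: ifP => [/bigcupP[j Pjj ij]|_]; last by apply: sumr_ge0 => j _; case: ifP.
by rewrite (bigD1 j) //= ij lerDl sumr_ge0 // => l _; case: ifP.
Qed.

(** Each run is counted in [others] for exactly [k] of the [k.+1] indices. *)
Lemma sum_others_cost k (ws : {ffun 'I_k.+1 -> realization U m}) :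
  \sum_i \sum_(j in others (probed pi) ws i) c j <=
  \sum_i k%:R * (adapt_result c pi (ws i)).2.
Proof.
have c_ge0 i : 0 <= c i by exact: ltW.
apply: (@le_trans _ _ (\sum_i \sum_(j | j != i) (adapt_result c pi (ws j)).2)).
  apply: ler_sum => i _; apply: le_trans (sum_bigcup_le _ _ c_ge0) _.
  by apply: ler_sum => j _; exact: cost_probed.
rewrite (exchange_big_dep xpredT) //=; apply: ler_sum => j _.
rewrite sumr_const mulr_natl (eq_card (B := predC1 j)) ?cardC1 ?card_ord // => i.
by rewrite !inE eq_sym.
Qed.

Variable V : state U m -> R.

(* [lam] trades cost against potential; quantifying over it replaces the
   random choice of the probed set by a deterministic one. *)
Definition one_round (k : nat) (rho : R) : Prop :=
  forall (lam : R) (st : state U m), 0 <= lam -> exists N : {set 'I_m},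
    \sum_(x | agrees st x) D x * (lam * \sum_(j in N) c j + V (observe_set st x N)) <=
    \sum_(x | agrees st x) D x * (lam * (k%:R * (adapt_result c pi x).2) + rho * V st).

(** [M] is the mass of [st] and [mu] the conditional law. [F] need dominate the new potential only
    on average over [x], as is the case for independent items. *)
Lemma one_round_leave_one_out (k : nat) (rho lam : R) (st : state U m)
    (M : R) (mu : realization U m -> R) (F : realization U m -> {set 'I_m} -> R) :
  0 <= lam -> 0 <= M -> (forall x, 0 <= mu x) -> \sum_x mu x = 1 ->
  (forall x, (if agrees st x then D x else 0) = M * mu x) ->
  (forall N, \sum_x mu x * V (observe_set st x N) <= \sum_x mu x * F x N) ->
  (forall ws : {ffun 'I_k.+1 -> realization U m}, (forall i, 0 < mu (ws i)) ->
     \sum_i F (ws i) (others (probed pi) ws i) <= k.+1%:R * (rho * V st)) ->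
  exists N : {set 'I_m},
    \sum_(x | agrees st x) D x * (lam * \sum_(j in N) c j + V (observe_set st x N)) <=
    \sum_(x | agrees st x) D x * (lam * (k%:R * (adapt_result c pi x).2) + rho * V st).
Proof.
move=> lam0 M0 mu0 mu1 DE VF FV.
pose b x := lam * (k%:R * (adapt_result c pi x).2) + rho * V st.
have [|N HN] := @leave_one_out _ _ _ mu (probed pi) mu0 mu1 k
    (fun x N => lam * \sum_(j in N) c j + F x N) b.
  move=> ws pos; rewrite !big_split /= sumr_const card_ord -[X in _ <= _ + X]mulr_natl.
  by apply: lerD; [rewrite -mulr_sumr -mulr_sumr ler_wpM2l ?sum_others_cost|exact: FV].
exists N; have sumE (h : realization U m -> R) :
    \sum_(x | agrees st x) D x * h x = M * \sum_x mu x * h x.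
  rewrite big_mkcond mulr_sumr; apply: eq_bigr => x _.
  by rewrite mulrA -DE; case: ifP => // _; rewrite mul0r.
rewrite !sumE ler_wpM2l //; apply: le_trans HN.
under eq_bigr do rewrite mulrDr.
under [leRHS]eq_bigr do rewrite mulrDr.
by rewrite !big_split /= lerD2l.
Qed.

Lemma one_round_null (k : nat) (rho lam : R) (st : state U m) :
  (forall x, agrees st x -> D x = 0) ->
  exists N : {set 'I_m},
    \sum_(x | agrees st x) D x * (lam * \sum_(j in N) c j + V (observe_set st x N)) <=
    \sum_(x | agrees st x) D x * (lam * (k%:R * (adapt_result c pi x).2) + rho * V st).
Proof.
move=> D0; exists set0.
have sum0 (h : realization U m -> R) : \sum_(x | agrees st x) D x * h x = 0.
  by apply: big1 => x stx; rewrite D0 ?mul0r.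
by rewrite !sum0.
Qed.

Lemma rounds_potential k rho r lam : 0 < rho -> 0 <= lam -> \sum_x D x = 1 ->
  one_round k rho -> exists sigma,
    lam * rounds_cost c D sigma r + expected D (fun x => V (rounds_run c sigma x r).1) <=
    lam * (r%:R * k%:R * adapt_cost c D pi) + rho ^+ r * V (init_state U m).
Proof.
move=> rho0 + D1 round; elim: r lam => [|r IHr] lam lam0.
  exists (fun _ _ => set0); rewrite rounds_cost_empty /expected /= -mulr_suml D1.
  by rewrite !mul0r !mulr0 !add0r.
(* The last round multiplies the earlier bound by [rho], which restores the weight [lam] on the
   earlier costs. *)
have [sigma' H'] := IHr (lam / rho) (divr_ge0 lam0 (ltW rho0)).
have [N HN] := fin_all_exists (fun st => round lam st lam0).
pose sigma n := if n == r then N else sigma' n; exists sigma.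
have runE x : rounds_run c sigma x r = rounds_run c sigma' x r.
  by apply: rounds_run_ext => i ir; rewrite /sigma ltn_eqF.
pose S x := (rounds_run c sigma' x r).1.
pose EV := expected D (fun x => V (S x)).
have step : \sum_x D x * (lam * \sum_(j in N (S x)) c j + V (observe_set (S x) x (N (S x))))
    <= lam * (k%:R * adapt_cost c D pi) + rho * EV.
  apply: (le_trans (rounds_sum_le sigma' r HN)).
  rewrite /EV /adapt_cost /expected !mulr_sumr -big_split /=.
  by apply: ler_sum => x _; rewrite mulrDr !(mulrCA (D x)).
have rhoK : rho * lam / rho = lam by rewrite mulrAC divff ?mul1r ?gt_eqF.
move: H'; rewrite -(ler_pM2l rho0) !mulrDr !(mulrA rho) rhoK -exprS -/EV => H'.
have -> : lam * rounds_cost c D sigma r.+1 + expected D (fun x => V (rounds_run c sigma x r.+1).1)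
   = lam * rounds_cost c D sigma' r +
     \sum_x D x * (lam * \sum_(j in N (S x)) c j + V (observe_set (S x) x (N (S x)))).
  rewrite /rounds_cost /expected !mulr_sumr -!big_split /=; apply: eq_bigr => x _.
  rewrite runE /sigma eqxx -/(S x) !mulrDr addrA.
  by congr (_ + _ + _); rewrite mulrCA.
apply: (le_trans (lerD (lexx _) step)).
rewrite addrCA; apply: (le_trans (lerD (lexx _) H')).
by rewrite addrA -mulrDr -(mulrA r%:R) -[X in lam * (X + _)]mul1r -mulrDl nat1r (mulrA r.+1%:R).
Qed.

End Rounds.

(** * The two potentials and the choice of parameters *)

Section Potentials.
Variables (R : realType) (U : finType) (m : nat) (f : {set U} -> nat) (c : 'I_m -> R).
Hypotheses (f_mono : monotone_fun f) (c_gt0 : forall i, 0 < c i).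

Lemma feasible_probed (D : realization U m -> R) pi x :
  adapt_feasible c f D pi -> 0 < D x -> f (x @: probed pi x) = f [set: U].
Proof.
move=> feas /feas/eqP; rewrite /adapt_result adapt_run_state.
by rewrite obs_observe_set ?agrees_init // obs_init set0U.
Qed.

Definition uncovered (st : state U m) : R := (f [set: U])%:R - (f (obs_set st))%:R.

Lemma product_one_round (p : 'I_m -> U -> R) pi k :
  submodular f -> (forall i u, 0 <= p i u) -> (forall i, \sum_u p i u = 1) ->
  adapt_feasible c f (pweight p) pi ->
  one_round c (pweight p) pi uncovered k (2 / k.+1%:R).
Proof.
move=> f_sub p0 p1 feas lam st lam0.
(* Conditioning on [st] keeps the law a product: observed items become point masses, and [M] is the
   probability of their observed values. *)
pose p' i u : R := if st i is Some v then (u == v)%:R else p i u.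
pose M := \prod_i (if st i is Some v then p i v else 1).
have p'0 i u : 0 <= p' i u by rewrite /p'; case: (st i).
have p'1 i : \sum_u p' i u = 1.
  rewrite /p'; case: (st i) => [v|] //.
  by rewrite (bigD1 v) //= eqxx big1 ?addr0 // => u /negPf->.
have M0 : 0 <= M by apply: prodr_ge0 => i _; case: (st i).
have DE x : (if agrees st x then pweight p x else 0) = M * pweight p' x.
  rewrite /M /pweight -big_split /=; case: ifP => [/agreesP stx|].
    apply: eq_bigr => i _; rewrite /p'; case sti: (st i) => [v|]; last by rewrite mul1r.
    by rewrite (stx _ _ sti) eqxx mulr1.
  move=> /negbT; rewrite negb_forall => /existsP[i].
  rewrite (bigD1 i) //= /p'; case: (st i) => [v|] //=.
  by rewrite (inj_eq Some_inj) eq_sym => /negPf->; rewrite mulr0 mul0r.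
have [M_eq0|M_neq0] := eqVneq M 0.
  by apply: one_round_null => x stx; move: (DE x); rewrite stx M_eq0 mul0r.
have Mgt0 : 0 < M by rewrite lt_def M_neq0.
have pos x : 0 < pweight p' x -> agrees st x && (0 < pweight p x).
  by rewrite -(pmulr_rgt0 _ Mgt0) -DE; case: ifP => //; rewrite ltxx.
(* Values already observed are absorbed into the function, so [g set0] is the current coverage. *)
pose g A := f (obs_set st :|: A).
have g_mono : monotone_fun g by move=> A B AB; apply: f_mono; exact: setUS.
have g_sub : submodular g.
  move=> A B; rewrite /g setUUr setUIr; exact: f_sub.
have gT : g [set: U] = f [set: U] by rewrite /g setUT.
have g_covers x : 0 < pweight p' x -> g (x @: probed pi x) = g [set: U].
  move=> /pos/andP[_ Dx]; apply/eqP; rewrite eqn_leq g_mono ?subsetT //= gT.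
  by rewrite -(feasible_probed feas Dx); apply: f_mono; exact: subsetUr.
pose F x N := 2 * \sum_y pweight p' y * exclusive_gain R g pi N x y.
apply: (@one_round_leave_one_out _ _ _ _ _ c_gt0 _ _ _ _ _ _ M (pweight p') F) => //.
- exact: pweight_ge0.
- exact: sum_pweight.
- move=> N; have := residual_le_exclusive p'0 p'1 g_mono g_sub g_covers N.
  rewrite -(pair_bigA _ (fun x y => pweight p' x * pweight p' y * exclusive_gain R g pi N x y)) /=.
  rewrite mulr_sumr gT => H.
  rewrite (eq_bigr (fun x => pweight p' x * ((f [set: U])%:R - (g (x @: N))%:R))).
    apply: (le_trans H); apply: ler_sum => x _.
    by rewrite /F mulrCA !mulr_sumr; apply: ler_sum => y _; rewrite !mulrA.
  move=> x _; have [w0|wn0] := eqVneq (pweight p' x) 0; first by rewrite w0 !mul0r.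
  have /pos/andP[stx _] : 0 < pweight p' x by rewrite lt_def wn0 pweight_ge0.
  by rewrite /uncovered obs_observe_set.
move=> ws _; rewrite mulrA [_ * (2 / _)]mulrCA divff ?pnatr_eq0 // mulr1.
rewrite /F -mulr_sumr ler_wpM2l //.
rewrite exchange_big /= -[leRHS]mul1r -(sum_pweight p'1) mulr_suml.
apply: ler_sum => y _; rewrite -mulr_sumr ler_wpM2l ?pweight_ge0 //.
have := exclusive_gain_sum R pi g_mono g_sub ws y.
by rewrite gT /uncovered {2}/g setU0.
Qed.

(** The count ignores probabilities, so its initial value is at most the number of scenarios
    whatever their weights. *)
Definition scenarios_left (A : {set realization U m}) (st : state U m) : R :=
  if covers f st then 0 else #|[set x in A | agrees st x]|%:R.

(* If both [ws i] and [ws j] stay uncovered and some [x] is consistent with what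
   each reveals, then [ws i] and [ws j] agree on every item both runs probe, so
   the two runs coincide and each would have been covered by the other. *)
Lemma scenarios_left_sum (A : {set realization U m}) pi st n
    (ws : {ffun 'I_n -> realization U m}) :
  (forall i, agrees st (ws i)) ->
  (forall i, f (ws i @: probed pi (ws i)) = f [set: U]) ->
  \sum_i scenarios_left A (observe_set st (ws i) (others (probed pi) ws i)) <=
  scenarios_left A st.
Proof.
move=> agr cov; pose S i := observe_set st (ws i) (others (probed pi) ws i).
have obsS i : obs_set (S i) = obs_set st :|: ws i @: others (probed pi) ws i.
  exact: obs_observe_set.
have probed_covers i : probed pi (ws i) \subset others (probed pi) ws i -> covers f (S i).
  move=> sub; rewrite /covers eqn_leq f_mono ?subsetT //= -(cov i); apply: f_mono.
  by rewrite obsS; apply: subset_trans (subsetUr _ _); exact: imsetS.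
rewrite /scenarios_left; have [covst|ncov] := ifPn.
  rewrite big1 // => i _; rewrite -/(S i) ifT // /covers eqn_leq f_mono ?subsetT //=.
  by rewrite -(eqP covst) f_mono // obsS subsetUl.
pose H i := if covers f (S i) then set0 else [set x in A | agrees (S i) x].
rewrite (eq_bigr (fun i => #|H i|%:R)) => [|i _]; last first.
  by rewrite /H -/(S i); case: ifP; rewrite ?cards0.
rewrite -natr_sum ler_nat.
have dis i j x : x \in H i -> x \in H j -> i = j.
  rewrite /H; case: ifPn => [|ci]; first by rewrite inE.
  case: ifPn => [|_]; first by rewrite in_set0.
  rewrite !inE /S !agrees_observe_set // => /and3P[_ _ /forall_inP xi] /and3P[_ _ /forall_inP xj].
  apply/eqP; apply: contraNT ci => ij; apply: probed_covers.
  have subij : probed pi (ws j) \subset others (probed pi) ws i.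
    by apply: (bigcup_sup j); rewrite // eq_sym.
  have subji : probed pi (ws i) \subset others (probed pi) ws j.
    by apply: (bigcup_sup i).
  suff -> : probed pi (ws i) = probed pi (ws j) by [].
  suff E : trace pi (ws i) = trace pi (ws j) by rewrite /probed E.
  apply: trace_eq => e /andP[ei ej].
  by rewrite (eqP (xi e (subsetP subij _ ej))) (eqP (xj e (subsetP subji _ ei))).
apply: (@leq_trans #|\bigcup_i H i|).
  rewrite -sum1_card [leqRHS]big_mkcond /=.
  under eq_bigr do rewrite -sum1_card big_mkcond /=.
  rewrite exchange_big /=; apply: leq_sum => x _.
  have [i xi|none] := pickP (fun i => x \in H i); last by rewrite big1 // => i _; rewrite none.
  rewrite ifT; last by apply/bigcupP; exists i.
  rewrite (bigD1 i) //= xi big1 ?addn0 // => j ji; case: ifP => // xj.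
  by rewrite (dis _ _ _ xj xi) eqxx in ji.
apply: subset_leq_card; apply/bigcupsP => i _; rewrite /H; case: ifP => _.
  exact: sub0set.
apply/subsetP => x; rewrite !inE => /andP[->] /=.
by rewrite agrees_observe_set // => /andP[].
Qed.

(** The leave-one-out sum is at most the potential itself; the factor 2 is slack that gives both
    settings the same rate. *)
Lemma one_round_scenarios (D : realization U m -> R) (A : {set realization U m}) pi k :
  (forall x, 0 <= D x) -> adapt_feasible c f D pi ->
  one_round c D pi (scenarios_left A) k (2 / k.+1%:R).
Proof.
move=> D0 feas lam st lam0; pose M := \sum_(x | agrees st x) D x.
have M0 : 0 <= M by apply: sumr_ge0.
have [M_eq0|M_neq0] := eqVneq M 0.
  by apply: one_round_null => x stx; exact: (psumr_eq0P (fun x _ => D0 x) M_eq0).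
pose mu x := (if agrees st x then D x else 0) / M.
apply: (@one_round_leave_one_out _ _ _ _ _ c_gt0 _ _ _ _ _ _ M mu
          (fun x N => scenarios_left A (observe_set st x N))) => //.
- by move=> x; rewrite /mu divr_ge0 //; case: ifP.
- by rewrite /mu -mulr_suml -big_mkcond divff.
- by move=> x; rewrite /mu mulrC divfK.
move=> ws pos; rewrite mulrA [_ * (2 / _)]mulrCA divff ?pnatr_eq0 // mulr1.
have ws_pos i : agrees st (ws i) && (0 < D (ws i)).
  move: (pos i); rewrite /mu pmulr_lgt0 ?invr_gt0 ?lt_def ?M_neq0 //.
  by case: ifP; rewrite ?eqxx.
apply: le_trans (_ : scenarios_left A st <= _).
  apply: scenarios_left_sum => i; have /andP[agr Dpos] := ws_pos i => //.
  exact: feasible_probed feas Dpos.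
by rewrite mulr_natl mulr2n lerDl /scenarios_left; case: ifP.
Qed.

Lemma rounds_of_potential (D : realization U m -> R) (V : state U m -> R) (Z eta : R) r pi :
  (forall x, 0 <= D x) -> \sum_x D x = 1 -> adapt_feasible c f D pi ->
  (forall st, 0 <= V st) -> V (init_state U m) <= Z -> 1 <= Z ->
  (forall x st, 0 < D x -> agrees st x -> ~~ covers f st -> 1 <= V st) ->
  (forall k, one_round c D pi V k (2 / k.+1%:R)) ->
  (0 < r)%N -> 0 < eta <= 1 ->
  exists sigma, 1 - eta <= rounds_cover_prob c f D sigma r /\
    rounds_cost c D sigma r <= 8 * (r%:R / eta) * powR Z r%:R^-1 * adapt_cost c D pi.
Proof.
move=> D0 D1 feas V0 VZ Z1 V1 round r_gt0 /andP[eta0 eta1].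
(* A zero optimum is treated apart because [lam] divides by it; probing nothing then covers. *)
have [opt0|opt_neq0] := eqVneq (adapt_cost c D pi) 0.
  exists (fun _ _ => set0); rewrite rounds_cost_empty opt0 mulr0; split=> //.
  apply: (@le_trans _ _ 1); first by rewrite gerBl ltW.
  rewrite -D1; apply: ler_sum => x _; rewrite rounds_run_empty.
  have [Dx|] := boolP (0 < D x); first by rewrite (adapt_cost0 c_gt0 D0 feas opt0 Dx) mulr1.
  by rewrite lt_def D0 andbT negbK => /eqP->; rewrite mul0r.
have opt_gt0 : 0 < adapt_cost c D pi by rewrite lt_def opt_neq0 adapt_cost_ge0.
have r0 : 0 < r%:R :> R by rewrite ltr0n.
have Z0 : 0 < Z by exact: lt_le_trans Z1.
pose t := powR Z r%:R^-1; have t1 : 1 <= t.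
  have -> : 1 = powR 1 r%:R^-1 :> R by rewrite powR1.
  by rewrite ge0_ler_powR ?nnegrE ?invr_ge0 // ltW.
have t0 : 0 < t by exact: lt_le_trans t1.
have tr : t ^+ r = Z.
  by rewrite -powR_mulrn ?powR_ge0 // -powRrM mulVf ?gt_eqF // powRr1 // ltW.
(* With [k <= z < k.+1], [rho] is at most [eta / (2 t)], so [rho ^+ r * Z <= (eta / 2) ^+ r <= eta /
   2]; [1 <= z] ensures [k >= 1]. *)
pose z := 4 / eta * t; have z1 : 1 <= z.
  apply: (le_trans t1); rewrite ler_peMl ?(le_trans ler01 t1) //.
  by rewrite ler_pdivlMr // mul1r; lra.
have z0 : 0 <= z by exact: le_trans z1.
pose k := Num.truncn z.
have kz : k%:R <= z by rewrite -truncn_ge_nat.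
have zk : z < k.+1%:R by rewrite -truncn_le_nat.
have k0 : 0 < k%:R :> R by rewrite ltr0n truncn_gt0.
pose rho : R := 2 / k.+1%:R; have rho0 : 0 < rho by rewrite divr_gt0.
have rhoZ : rho ^+ r * Z <= eta / 2.
  have rho_le : rho <= eta / 2 / t.
    have -> : eta / 2 / t = 2 / z by rewrite /z; field; rewrite !gt_eqF.
    rewrite /rho ler_pM2l // lef_pV2 ?posrE ?ltr0n //; first exact: ltW.
    exact: lt_le_trans z1.
  rewrite -tr -exprMn; apply: (@le_trans _ _ ((eta / 2) ^+ r)).
    have rho_t : rho * t <= eta / 2 by rewrite -ler_pdivlMr.
    apply: lerXn2r => //; rewrite nnegrE; apply: ltW; first exact: mulr_gt0.
    exact: divr_gt0.
  rewrite -(prednK r_gt0) exprS ler_piMr ?exprn_ile1 //; lra.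
pose W := rho ^+ r * Z; have W0 : 0 < W by rewrite mulr_gt0 ?exprn_gt0.
(* This balances the bound: cost and potential terms contribute [W] each. Both summands on the left
   are nonnegative, so each is at most [2 W]. *)
pose lam := W / (r%:R * k%:R * adapt_cost c D pi).
have rk0 : 0 < r%:R * k%:R * adapt_cost c D pi by rewrite !mulr_gt0.
have lam0 : 0 < lam by rewrite divr_gt0.
have [sigma H] := rounds_potential r rho0 (ltW lam0) D1 (round k).
exists sigma.
have {}H : lam * rounds_cost c D sigma r +
    expected D (fun x => V (rounds_run c sigma x r).1) <= W *+ 2.
  apply: (le_trans H); rewrite mulr2n lerD //.
    by rewrite /lam divfK // gt_eqF.
  by rewrite ler_wpM2l // exprn_ge0 // ltW.
split.
  suff: 1 - rounds_cover_prob c f D sigma r <= eta by rewrite lerBlDr lerBlDl.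
  (* Markov's inequality: [V] is at least 1 wherever coverage fails. *)
  apply: (@le_trans _ _ (expected D (fun x => V (rounds_run c sigma x r).1))).
    rewrite -D1 -sumrB; apply: ler_sum => x _; rewrite -[X in X - _]mulr1 -mulrBr.
    have [->|Dx] := eqVneq (D x) 0; first by rewrite !mul0r.
    rewrite ler_wpM2l //; case: (boolP (covers _ _)) => cov; first by rewrite subrr.
    rewrite subr0 (V1 x) ?agrees_rounds_run // lt_def Dx; exact: D0.
  apply: (@le_trans _ _ (W *+ 2)).
    by apply: le_trans H; rewrite lerDr mulr_ge0 ?rounds_cost_ge0 // ltW.
  by rewrite -mulr_natr -ler_pdivlMr.
rewrite -(ler_pM2l lam0); apply: (@le_trans _ _ (W *+ 2)).
  apply: le_trans H; rewrite lerDl; apply: sumr_ge0 => x _; exact: mulr_ge0.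
rewrite -/t.
have -> : W *+ 2 = lam * (2 * (r%:R * k%:R * adapt_cost c D pi)).
  by rewrite mulrCA /lam divfK ?gt_eqF // mulr_natl.
apply: ler_wpM2l; first exact: ltW.
rewrite mulrA; apply: ler_wpM2r; first exact: adapt_cost_ge0.
have -> : 8 * (r%:R / eta) * t = 2 * (r%:R * z).
  by rewrite /z; field; rewrite gt_eqF.
by apply: ler_wpM2l => //; apply: ler_wpM2l.
Qed.

Lemma adapt_run_ext (pi pi' : state U m -> option 'I_m) x n st : pi =1 pi' ->
  adapt_run c pi x n st = adapt_run c pi' x n st.
Proof.
by move=> E; elim: n st => //= n IHn st; rewrite E; case: (pi' st) => // i; rewrite IHn.
Qed.

Lemma rounds_all_cover (D : realization U m -> R) r : \sum_x D x = 1 ->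
  (forall x, 0 <= D x) ->
  (forall x : realization U m, 0 < D x -> f [set x i | i : 'I_m] = f [set: U]) ->
  (0 < r)%N -> rounds_cover_prob c f D (fun _ _ => [set: 'I_m]) r = 1.
Proof.
move=> D1 D0 cov; case: r => // r _; rewrite -D1; apply: eq_bigr => x _.
have [->|Dx] := eqVneq (D x) 0; first by rewrite mul0r.
rewrite [covers _ _](_ : _ = true) ?mulr1 //=.
rewrite /covers obs_observe_set ?agrees_rounds_run //.
rewrite eqn_leq f_mono ?subsetT //= -(cov x) ?lt_def ?Dx ?D0 //.
apply: f_mono; apply: subset_trans (subsetUr _ _).
by apply/subsetP => _ /imsetP[i _ ->]; apply: imset_f; rewrite inE.
Qed.

(** One [sigma] must serve all feasible policies. States are finite, so policies can be taken from a
    finite type and a cheapest feasible one exists as soon as any does. *)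
Lemma rounds_vs_optimal (D : realization U m -> R) (K eta : R) r :
  (forall x, 0 <= D x) -> \sum_x D x = 1 ->
  (forall x : realization U m, 0 < D x -> f [set x i | i : 'I_m] = f [set: U]) ->
  (0 < r)%N -> 0 <= eta -> 0 <= K ->
  (forall pi, adapt_feasible c f D pi -> exists sigma,
     1 - eta <= rounds_cover_prob c f D sigma r /\
     rounds_cost c D sigma r <= K * adapt_cost c D pi) ->
  exists sigma, 1 - eta <= rounds_cover_prob c f D sigma r /\
    forall pi, adapt_feasible c f D pi ->
      rounds_cost c D sigma r <= K * adapt_cost c D pi.
Proof.
move=> D0 D1 cov r0 eta0 K0 H.
pose feasb (h : {ffun state U m -> option 'I_m}) :=
  [forall x, (0 < D x) ==> covers f (adapt_result c h x).1].
have feasE pi : adapt_feasible c f D pi -> feasb (finfun pi).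
  move=> feas; apply/forallP => x; apply/implyP => /feas.
  by rewrite /adapt_result (adapt_run_ext (pi' := pi)) // => st; rewrite ffunE.
have costE pi : adapt_cost c D pi = adapt_cost c D (finfun pi).
  apply: eq_bigr => x _.
  by rewrite /adapt_result (adapt_run_ext (pi' := pi)) // => st; rewrite ffunE.
have [h0 feas0|none] := pickP feasb; last first.
  exists (fun _ _ => setT); rewrite rounds_all_cover // gerBl; split=> // pi /feasE.
  by rewrite none.
pose cost (h : {ffun state U m -> option 'I_m}) : R := adapt_cost c D h.
have [h feas_h minh] := Order.TotalTheory.arg_minP cost feas0.
have [|sigma [sigma_cov sigma_cost]] := H h.
  by move=> x Dx; exact: (implyP (forallP feas_h x)).
exists sigma; split=> // pi /feasE/minh le_h; apply: (le_trans sigma_cost).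
by rewrite (costE pi); apply: ler_wpM2l.
Qed.

(** Disposes of the cases outside the potential argument by probing nothing: [eta >= 1], and
    [Q = 0], where [1 <= Z] fails for [Z = Q]. *)
Lemma rounds_trivial (D : realization U m -> R) (K eta : R) r :
  (forall x, 0 <= D x) -> \sum_x D x = 1 -> 0 <= eta -> 0 <= K ->
  1 <= eta \/ f [set: U] = 0%N ->
  exists sigma, 1 - eta <= rounds_cover_prob c f D sigma r /\
    forall pi, adapt_feasible c f D pi ->
      rounds_cost c D sigma r <= K * adapt_cost c D pi.
Proof.
move=> D0 D1 eta0 K0 triv; exists (fun _ _ => set0); split; last first.
  by move=> pi _; rewrite rounds_cost_empty mulr_ge0 ?adapt_cost_ge0.
case: triv => [eta1|Q0].
  apply: (@le_trans _ _ 0); first by rewrite subr_le0.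
  by apply: sumr_ge0 => x _; rewrite mulr_ge0.
apply: (@le_trans _ _ 1); first by rewrite gerBl.
rewrite -D1; apply: ler_sum => x _; rewrite rounds_run_empty /covers Q0.
by rewrite -leqn0 -Q0 f_mono ?subsetT // mulr1.
Qed.

End Potentials.

(** * Scenario distributions and the two final bounds *)

Lemma sum_scenario_dist (R : realType) (U : finType) (m s : nat) (q : 'I_s -> R)
  (X : 'I_s -> realization U m) : \sum_x scenario_dist q X x = \sum_w q w.
Proof. by rewrite [RHS](partition_big X xpredT). Qed.

Lemma scenario_dist_gt0 (R : realType) (U : finType) (m s : nat) (q : 'I_s -> R)
  (X : 'I_s -> realization U m) x : 0 < scenario_dist q X x -> exists w, X w = x.
Proof.
have [w /eqP<-|none] := pickP (fun w => X w == x); first by exists w.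
by rewrite /scenario_dist big_pred0 ?ltxx.
Qed.

Theorem mainTheorem7 :
  exists C : nat,
  (* (a) stochastic submodular cover *)
  (forall (R : realType) (U : finType) (m : nat) (f : {set U} -> nat)
     (c : 'I_m -> R) (p : 'I_m -> {ffun U -> R}) (r : nat) (eta : R),
     monotone_fun f -> submodular f ->
     (forall i, 0 < c i) ->
     (forall i u, 0 <= p i u) -> (forall i, \sum_(u : U) p i u = 1) ->
     (forall x : realization U m, 0 < product_dist p x ->
        f [set x i | i : 'I_m] = f [set: U]) ->
     (1 <= r)%N -> 0 < eta ->
     let D := product_dist p in
     let Q : R := (f [set: U])%:R in
     exists sigma : nat -> state U m -> {set 'I_m},
       1 - eta <= rounds_cover_prob c f D sigma r /\
       forall pi : state U m -> option 'I_m,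
         adapt_feasible c f D pi ->
         rounds_cost c D sigma r
           <= C%:R * (r%:R / eta) * powR Q (r%:R)^-1 * (1 + ln Q)
              * adapt_cost c D pi) /\
  (* (b) scenario submodular cover *)
  (forall (R : realType) (U : finType) (m : nat) (f : {set U} -> nat)
     (c : 'I_m -> R) (s : nat) (q : 'I_s -> R) (X : 'I_s -> realization U m)
     (r : nat) (eta : R),
     monotone_fun f -> submodular f ->
     (forall i, 0 < c i) ->
     (forall w, 0 < q w) -> \sum_(w < s) q w = 1 ->
     (forall w, f [set X w i | i : 'I_m] = f [set: U]) ->
     (1 <= r)%N -> 0 < eta ->
     let D := scenario_dist q X in
     let Q : R := (f [set: U])%:R in
     exists sigma : nat -> state U m -> {set 'I_m},
       1 - eta <= rounds_cover_prob c f D sigma r /\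
       forall pi : state U m -> option 'I_m,
         adapt_feasible c f D pi ->
         rounds_cost c D sigma r
           <= C%:R * (r%:R / eta) * powR (s%:R) (r%:R)^-1
              * (1 + ln (s%:R) + r%:R * ln Q)
              * adapt_cost c D pi).
Proof.
exists 8; split.
- move=> R U m f c p r eta f_mono f_sub c0 p0 p1 cov r0 eta0 D Q.
  have D0 x : 0 <= D x by apply: prodr_ge0 => i _; exact: p0.
  have D1 : \sum_x D x = 1 by exact: (sum_pweight (p := fun i => p i) p1).
  have lnQ : 0 <= ln Q.
    rewrite /Q; case: (f _) => [|n]; first by rewrite ln0.
    by rewrite ln_ge0 // ler1n.
  have K0 : 0 <= 8 * (r%:R / eta) * powR Q r%:R^-1.
    by rewrite !mulr_ge0 ?invr_ge0 ?powR_ge0 // ltW.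
  (* The potential argument gives the bound without the logarithmic factor, which is at least 1. *)
  have K1 : 8 * (r%:R / eta) * powR Q r%:R^-1 <= 8 * (r%:R / eta) * powR Q r%:R^-1 * (1 + ln Q).
    by rewrite ler_peMr // lerDl.
  have [K2 eta_ge0] := (le_trans K0 K1, ltW eta0).
  have [Q0|Qpos] := posnP (f [set: U]).
    by apply: rounds_trivial => //; right.
  have [eta1|eta1] := leP 1 eta.
    by apply: rounds_trivial => //; left.
  apply: rounds_vs_optimal => // pi feas.
  have [|||||||sigma [sigma_cov sigma_cost]] :=
    @rounds_of_potential R U m f c c0 D (uncovered R f) Q eta r pi D0 D1 feas.
  - by move=> st; rewrite subr_ge0 ler_nat f_mono ?subsetT.
  - by rewrite /uncovered gerBl.
  - by rewrite ler1n.
  (* [f] is integer-valued, so an uncovered state misses at least 1. *)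
  - move=> x st _ _; rewrite /covers /uncovered => ncov.
    rewrite -natrB ?f_mono ?subsetT // ler1n subn_gt0 ltn_neqAle ncov f_mono ?subsetT //.
  - by move=> k; exact: (@product_one_round _ _ _ _ _ f_mono c0 (fun i => p i)).
  - exact: r0.
  - by rewrite eta0 ltW.
  exists sigma; split=> //; apply: (le_trans sigma_cost).
  by rewrite ler_wpM2r ?adapt_cost_ge0.
move=> R U m f c s q X r eta f_mono f_sub c0 q0 q1 cov r0 eta0 D Q.
have D0 x : 0 <= D x by apply: sumr_ge0 => w _; exact: ltW.
have D1 : \sum_x D x = 1 by rewrite sum_scenario_dist.
have covD (x : realization U m) : 0 < D x -> f [set x i | i : 'I_m] = f [set: U].
  by move=> /scenario_dist_gt0[w <-].
have s0 : (0 < s)%N.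
  by case: s q X q0 q1 {cov D D0 D1 covD} => // q X _ /eqP; rewrite big_ord0 eq_sym oner_eq0.
have lnQ : 0 <= ln Q.
  rewrite /Q; case: (f _) => [|n]; first by rewrite ln0.
  by rewrite ln_ge0 // ler1n.
have K0 : 0 <= 8 * (r%:R / eta) * powR s%:R r%:R^-1.
  by rewrite !mulr_ge0 ?invr_ge0 ?powR_ge0 // ltW.
have K1 : 8 * (r%:R / eta) * powR s%:R r%:R^-1 <=
    8 * (r%:R / eta) * powR s%:R r%:R^-1 * (1 + ln s%:R + r%:R * ln Q).
  by rewrite ler_peMr // -addrA lerDl addr_ge0 ?ln_ge0 ?ler1n // mulr_ge0.
have [K2 eta_ge0] := (le_trans K0 K1, ltW eta0).
have [eta1|eta1] := leP 1 eta.
  by apply: rounds_trivial => //; left.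
apply: rounds_vs_optimal => // pi feas.
pose A := [set X w | w : 'I_s].
have [|||||||sigma [sigma_cov sigma_cost]] :=
  @rounds_of_potential R U m f c c0 D (scenarios_left R f A) s%:R eta r pi D0 D1 feas.
- by move=> st; rewrite /scenarios_left; case: ifP.
- rewrite /scenarios_left; case: ifP => // _; rewrite ler_nat.
  apply: (@leq_trans #|A|).
    by apply: subset_leq_card; apply/subsetP => x; rewrite inE => /andP[].
  by apply: leq_trans (leq_imset_card _ _) _; rewrite card_ord.
- by rewrite ler1n.
- move=> x st /scenario_dist_gt0[w <-] agr ncov.
  rewrite /scenarios_left (negPf ncov) ler1n card_gt0; apply/set0Pn; exists (X w).
  by rewrite inE agr imset_f.
- by move=> k; exact: one_round_scenarios.
- exact: r0.
- by rewrite eta0 ltW.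
exists sigma; split=> //; apply: (le_trans sigma_cost).
by rewrite ler_wpM2r ?adapt_cost_ge0.
Qed.
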